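(* For integers $d$ and $\ell$ with $2\leq\ell\leq d$, there exists a constant $C=C(\ell)$ such that the following holds. Let $A_1,\ldots,A_\ell,A_{\ell+1}\subseteq\mathbb{F}_q^d$ and let $S\subseteq\prod_{i=1}^{\ell+1}A_i$ with $|S|\sim\prod_{i=1}^{\ell+1}|A_i|$. Define $$S'=\{(x_1,\ldots,x_\ell)\in\textstyle\prod_{i=1}^\ell A_i:(x_1,\ldots,x_\ell,x_{\ell+1})\in S\text{ for some }x_{\ell+1}\in A_{\ell+1}\},$$ and for $(x_1,\ldots,x_\ell)\in S'$ define $S(x_1,\ldots,x_\ell)=\{x_{\ell+1}\in A_{\ell+1}:(x_1,\ldots,x_\ell,x_{\ell+1})\in S\}$ and $$\Pi_{x_1,\ldots,x_\ell}(S(x_1,\ldots,x_\ell))=\{(x_1\cdot x_{\ell+1},\ldots,x_\ell\cdot x_{\ell+1})\in\mathbb{F}_q^\ell: x_{\ell+1}\in S(x_1,\ldots,x_\ell)\}.$$ If $|A_i||A_{\ell+1}|\geq Cq^{d+\ell}$ for $1\leq i\leq\ell$, then $$\frac{1}{|S'|}\sum_{(x_1,\ldots,x_\ell)\in S'}\left|\Pi_{x_1,\ldots,x_\ell}(S(x_1,\ldots,x_\ell))\right|\gtrsim q^\ell.$$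
   Context: $\mathbb{F}_q$ is the finite field with $q$ elements and $x\cdot y=\sum_{i=1}^d x_iy_i$ for $x,y\in\mathbb{F}_q^d$. Notation: $X\lesssim Y$ means there is a constant $C'$ (independent of $q$ and of the sets involved) with $X\leq C'Y$; $X\gtrsim Y$ means $Y\lesssim X$; $X\sim Y$ means both $X\lesssim Y$ and $Y\lesssim X$. *)

(* Defs.v *)
From HB Require Import structures.
From mathcomp Require Import all_boot all_order all_algebra.
From mathcomp Require Import reals.

Set Implicit Arguments.
Unset Strict Implicit.
Unset Printing Implicit Defensive.

Import Order.TTheory GRing.Theory Num.Theory.
Local Open Scope ring_scope.

(* The implied constant [K] is explicit, so that its dependencies can be read
   off the order of the quantifiers in a statement. *)
Definition lesssim (R : realType) (K X Y : R) : Prop := X <= K * Y.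

Definition lessgtrsim (R : realType) (K X Y : R) : Prop :=
  lesssim K X Y /\ lesssim K Y X.

Definition dotp (F : finFieldType) (d : nat) (x y : 'rV[F]_d) : F :=
  \sum_(i < d) x 0 i * y 0 i.

(* An n-tuple of vectors of F^d is a finite function on 'I_n; indices start
   at 0, so A_i and x_i are [A] and [x] at the ordinal i - 1. *)
Definition prodset (F : finFieldType) (d n : nat)
    (A : 'I_n -> {set 'rV[F]_d}) : {set {ffun 'I_n -> 'rV[F]_d}} :=
  [set x : {ffun 'I_n -> 'rV[F]_d} | [forall i, x i \in A i]].

Definition init_ord (l : nat) (i : 'I_l) : 'I_l.+1 := widen_ord (leqnSn l) i.

(* (x_1, ..., x_l), y |-> (x_1, ..., x_l, y) *)
Definition snoc (F : finFieldType) (d l : nat)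
    (x : {ffun 'I_l -> 'rV[F]_d}) (y : 'rV[F]_d) :
    {ffun 'I_l.+1 -> 'rV[F]_d} :=
  [ffun i : 'I_l.+1 => if insub (val i) is Some j then x j else y].

(* S(x_1, ..., x_l) *)
Definition fiber (F : finFieldType) (d l : nat)
    (A : 'I_l.+1 -> {set 'rV[F]_d}) (S : {set {ffun 'I_l.+1 -> 'rV[F]_d}})
    (x : {ffun 'I_l -> 'rV[F]_d}) : {set 'rV[F]_d} :=
  [set y in A ord_max | snoc x y \in S].

(* S' *)
Definition shadow (F : finFieldType) (d l : nat)
    (A : 'I_l.+1 -> {set 'rV[F]_d}) (S : {set {ffun 'I_l.+1 -> 'rV[F]_d}}) :
    {set {ffun 'I_l -> 'rV[F]_d}} :=
  [set x in prodset (fun i => A (init_ord i))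
     | [exists y in A ord_max, snoc x y \in S]].

(* \Pi_{x_1, ..., x_l}(E) *)
Definition dotprods (F : finFieldType) (d l : nat)
    (x : {ffun 'I_l -> 'rV[F]_d}) (E : {set 'rV[F]_d}) : {set 'rV[F]_l} :=
  [set \row_(i < l) dotp (x i) y | y in E].

(* Main.v *)
(* Let E be the last set and M the number of triples (x, y, y') with x in the
   product of the other A_i, y and y' in E, and x_i.(y - y') = 0 for all i.
   Cauchy-Schwarz for the fibers of (x, y) |-> (x, (x_i.y)_i) on S gives
   |S|^2 <= M * \sum_(x in S') |Pi_x(S(x))|, so it is enough to show that M is
   at most a constant times q^-l |E|^2 \prod_i |A_i|.
   Let g_i(z) be the proportion of x in A_i orthogonal to z.  As 0 <= g_i <= 1,
   \prod_i g_i <= (2/q)^l + 4 \sum_i (g_i - 1/q)^2, and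
   \sum_z (g_i(z) - 1/q)^2 <= q^d / |A_i|.  A difference y - y' = z has at most
   |E| representations, so the second term contributes at most
   4 \sum_i |E| q^d / |A_i|, which is <= 4 l |E|^2 q^-l when
   |A_i| |E| >= q^(d+l): C = 1 suffices, with K' = K^2 (2^l + 4 l). *)

Require Import Defs.
From mathcomp Require Import all_boot all_order all_algebra.
From mathcomp Require Import reals.
From mathcomp Require Import ring lra.

Import Order.TTheory GRing.Theory Num.Theory.
Local Open Scope ring_scope.

(** * Cauchy-Schwarz on fiber sizes *)

(** With [n u] the size of the fiber over [u], the left side is the square of the sum of the [n u],
    and the collisions number the sum of their squares. *)
Lemma card_imset_collisions (T U : finType) (f : T -> U) (D : {set T}) :
  (#|D| ^ 2 <= #|f @: D| *
     #|[set p : T * T | [&& p.1 \in D, p.2 \in D & f p.1 == f p.2]]|)%N.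
Proof.
pose n u := #|[set x in D | f x == u]|.
have cardD : #|D| = (\sum_(u in f @: D) n u)%N.
  rewrite -sum1_card (partition_big_imset f) /=.
  by apply: eq_bigr => u _; rewrite /n -sum1dep_card.
have -> : #|[set p : T * T | [&& p.1 \in D, p.2 \in D & f p.1 == f p.2]]|
    = (\sum_(u in f @: D) n u ^ 2)%N.
  rewrite -sum1dep_card
    -(pair_big_dep (mem D) (fun x y => (y \in D) && (f x == f y))
        (fun _ _ => 1%N)) /=.
  rewrite (partition_big_imset f) /=.
  apply: eq_bigr => u _; rewrite -mulnn {1}/n -sum1dep_card big_distrl /=.
  apply: eq_bigr => x /andP[_ /eqP <-]; rewrite mul1n /n -sum1dep_card.
  by apply: eq_bigl => y; rewrite eq_sym.
(* Doubling allows 2 n_u n_v <= n_u^2 + n_v^2 to be summed over all pairs (u, v) inside the natural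
   numbers. *)
rewrite cardD -(leq_pmul2l (isT : 0 < 2)%N) -mulnn big_distrl /= big_distrr /=.
set P := f @: D.
apply: (@leq_trans (\sum_(u in P) \sum_(v in P) (n u ^ 2 + n v ^ 2))%N).
  apply: leq_sum => u _; rewrite big_distrr big_distrr /=.
  by apply: leq_sum => v _; apply: nat_Cauchy.
under eq_bigr => u _ do rewrite big_split /= sum_nat_const.
by rewrite big_split /= sum_nat_const -big_distrr /= mul2n addnn.
Qed.

(** * Hyperplane counts and their variance *)

Section DotProduct.
Variables (F : finFieldType) (d : nat).
Implicit Types x y z w : 'rV[F]_d.

Lemma dotpBl x y z : dotp (x - y) z = dotp x z - dotp y z.
Proof. by rewrite -sumrB; apply: eq_bigr => i _; rewrite !mxE mulrBl. Qed.

Lemma dotpBr x y z : dotp x (y - z) = dotp x y - dotp x z.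
Proof. by rewrite -sumrB; apply: eq_bigr => i _; rewrite !mxE mulrBr. Qed.

Lemma dotpDr x y z : dotp x (y + z) = dotp x y + dotp x z.
Proof. by rewrite -big_split; apply: eq_bigr => i _; rewrite !mxE mulrDr. Qed.

Lemma dotp_scale_delta w i a : dotp w (a *: delta_mx 0 i) = w 0 i * a.
Proof.
rewrite /dotp (bigD1 i) //= big1 ?addr0 => [|j ji]; rewrite !mxE eqxx /=.
  by rewrite eqxx mulr1.
by rewrite (negPf ji) !mulr0.
Qed.

(** The level sets of z |-> w.z partition the space, and all are translates of the one at 0. *)
Lemma card_orthogonal w : w != 0 ->
  (#|F| * #|[set z | dotp w z == 0%R]| = #|F| ^ d)%N.
Proof.
move=> w0; have [i wi0] : exists i, w 0 i != 0.
  apply/existsP; apply: contraNT w0 => /existsPn w0; apply/eqP/rowP => i.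
  by rewrite mxE; apply/eqP; have := w0 i; rewrite negbK.
have cardV : #|{: 'rV[F]_d}| = (#|F| ^ d)%N by rewrite card_mx mul1n.
rewrite -cardV -[RHS]sum1_card (partition_big (dotp w) predT) //= -sum_nat_const.
apply: eq_bigr => t _; rewrite sum1dep_card.
pose v : 'rV[F]_d := (t / w 0 i) *: delta_mx 0 i.
have wv : dotp w v = t by rewrite dotp_scale_delta mulrC divfK.
rewrite -[LHS](card_imset _ (can_inj (addrK v))); apply: eq_card => z.
rewrite [RHS]inE; apply/imsetP/eqP => [[y]|wz].
  by rewrite inE => /eqP y0 ->; rewrite dotpDr y0 wv add0r.
by exists (z - v); rewrite ?subrK // inE dotpBr wv wz subrr.
Qed.

Variable R : realFieldType.
Let q : R := #|F|%:R.

Let q_gt0 : 0 < q. Proof. by rewrite ltr0n; apply/card_gt0P; exists 0. Qed.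

Let cardV : #|{: 'rV[F]_d}|%:R = q ^+ d.
Proof. by rewrite card_mx mul1n natrX. Qed.

(* The second moment is computed over all the affine hyperplanes
   {x : x.z = t}; those with t = 0 contribute only part of it. *)
Lemma orthogonal_variance (A : {set 'rV[F]_d}) :
  \sum_z (#|[set x in A | dotp x z == 0]|%:R - #|A|%:R / q) ^+ 2
    <= #|A|%:R * q ^+ d.
Proof.
pose h z t := #|[set x in A | dotp x z == t]|.
have hE z t : (h z t)%:R = \sum_(x in A) (dotp x z == t)%:R :> R.
  rewrite /h -sum1dep_card natr_sum big_mkcondr.
  by apply: eq_bigr => x _; case: (_ == _).
have sum_h z : \sum_t (h z t)%:R = #|A|%:R :> R.
  under eq_bigr => t _ do rewrite hE.
  rewrite exchange_big /= -sum1_card natr_sum; apply: eq_bigr => x _.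
  by rewrite (bigD1 (dotp x z)) //= eqxx big1 ?addr0 // => t /negPf;
    rewrite eq_sym => ->.
have sum_h2 z : \sum_t (h z t)%:R ^+ 2 =
    \sum_(x in A) \sum_(y in A) (dotp (x - y) z == 0)%:R :> R.
  under eq_bigr => t _ do rewrite expr2 {1}hE big_distrl /=.
  rewrite exchange_big /=; apply: eq_bigr => x _.
  rewrite (bigD1 (dotp x z)) //= eqxx mul1r big1 ?addr0 => [|t /negPf]; last first.
    by rewrite eq_sym => ->; rewrite mul0r.
  rewrite hE; apply: eq_bigr => y _.
  by rewrite dotpBl subr_eq0 eq_sym.
apply: (@le_trans _ _ (\sum_z \sum_t ((h z t)%:R - #|A|%:R / q) ^+ 2)).
  apply: ler_sum => z _; rewrite (bigD1 0) //= lerDl.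
  by apply: sumr_ge0 => t _; apply: sqr_ge0.
(* The cross term simplifies because |A| / q is the mean of [h z t] over t. *)
have -> : \sum_z \sum_t ((h z t)%:R - #|A|%:R / q) ^+ 2 =
    \sum_z \sum_t (h z t)%:R ^+ 2 - q ^+ d * (#|A|%:R ^+ 2 / q).
  have <- : \sum_(z : 'rV[F]_d) (#|A|%:R ^+ 2 / q) = q ^+ d * (#|A|%:R ^+ 2 / q).
    by rewrite sumr_const -cardV mulr_natl.
  rewrite -sumrB; apply: eq_bigr => z _.
  under eq_bigr => t _ do rewrite sqrrB.
  rewrite big_split /= sumrB sumr_const -[_ *+ #|_|]mulr_natr -/q.
  rewrite sumrMnl -big_distrl /= sum_h.
  by field; rewrite gt_eqF.
rewrite lerBlDr.
under eq_bigr => z _ do rewrite sum_h2.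
rewrite exchange_big /=.
under eq_bigr => x _ do rewrite exchange_big /=.
have cardO w : w != 0 -> \sum_z (dotp w z == 0)%:R = q ^+ d / q.
  move=> /card_orthogonal w0; rewrite /q -natrX -w0 natrM mulrAC divff ?mul1r; last first.
    by rewrite gt_eqF.
  rewrite -sum1dep_card natr_sum [RHS]big_mkcond.
  by apply: eq_bigr => z _; case: (_ == _).
(* For each x, the pair (x, x) contributes q^d and every pair with y != x contributes q^(d-1); the
   latter are absorbed by the subtracted square of the mean. *)
have -> : #|A|%:R * q ^+ d + q ^+ d * (#|A|%:R ^+ 2 / q) =
   \sum_(x in A) (q ^+ d + \sum_(y in A) q ^+ d / q).
  by rewrite !sumr_const; field; rewrite gt_eqF.
apply: ler_sum => x xA; rewrite (bigD1 x) //= [in leRHS](bigD1 x) //=.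
apply: lerD; first by rewrite -cardV -sumr_const; apply: ler_sum => z _; case: eqP.
rewrite (@eq_bigr _ _ _ _ _ _ _ (fun=> q ^+ d / q)) ?lerDr ?divr_ge0 ?exprn_ge0 ?(ltW q_gt0) //.
by move=> y /andP[_ yx]; rewrite cardO // subr_eq0 eq_sym.
Qed.

End DotProduct.

(** * Averaging products of orthogonality proportions *)

(** Only the largest value g_m matters. If g_m > 2c, then g_m < 2 (g_m - c), while g_m^l <= g_m^2
    because g_m <= 1 and l >= 2. *)
Lemma prod_le_moments (R : realFieldType) (l : nat) (g : 'I_l -> R) (c : R) :
  (2 <= l)%N -> 0 <= c -> (forall i, 0 <= g i <= 1) ->
  \prod_i g i <= (2 * c) ^+ l + 4 * \sum_i (g i - c) ^+ 2.
Proof.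
case: l g => [//|l] g l2 c0 g01.
have [m _ gm] := @Order.TotalTheory.arg_maxP _ _ _ ord0 predT g isT.
have gle i : g i <= g m by exact: gm.
have [gm0 gm1] := andP (g01 m).
have prodm : \prod_i g i <= g m ^+ l.+1.
  have -> : g m ^+ l.+1 = \prod_(i < l.+1) g m by rewrite prodr_const card_ord.
  by apply: ler_prod => i _; rewrite gle andbT; case/andP: (g01 i).
apply: (le_trans prodm).
have sum_ge0 : 0 <= \sum_i (g i - c) ^+ 2 by apply: sumr_ge0 => i _; apply: sqr_ge0.
have pow_ge0 : 0 <= (2 * c) ^+ l.+1 by rewrite exprn_ge0 // mulr_ge0.
have [small|big] := leP (g m) (2 * c).
  apply: (@le_trans _ _ ((2 * c) ^+ l.+1)); last by rewrite lerDl mulr_ge0.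
  by rewrite lerXn2r // nnegrE ?mulr_ge0.
apply: (@le_trans _ _ (g m ^+ 2)); first exact: ler_wiXn2l.
apply: (@le_trans _ _ (4 * (g m - c) ^+ 2)); first by nra.
apply: (@le_trans _ _ (4 * \sum_i (g i - c) ^+ 2)); last by rewrite lerDr.
rewrite ler_pM2l // (bigD1 m) //= lerDl.
by apply: sumr_ge0 => i _; apply: sqr_ge0.
Qed.

Lemma sum_prod_orthogonal_le (R : realFieldType) (F : finFieldType) (d l : nat)
    (A : 'I_l -> {set 'rV[F]_d}) (E : {set 'rV[F]_d}) :
  (2 <= l)%N ->
  (forall i, #|F|%:R ^+ (d + l) <= #|A i|%:R * #|E|%:R :> R) ->
  \sum_(y in E) \sum_(y' in E)
      \prod_i (#|[set x in A i | dotp x (y - y') == 0]|%:R / #|A i|%:R)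
    <= (2 ^+ l + 4 * l%:R) * (#|E|%:R ^+ 2 / #|F|%:R ^+ l) :> R.
Proof.
move=> l2 large; set q : R := #|F|%:R.
have q0 : 0 < q by rewrite ltr0n; apply/card_gt0P; exists 0.
have AE0 i : 0 < #|A i|%:R * #|E|%:R :> R.
  by apply: lt_le_trans (large i); rewrite exprn_gt0.
have A0 i : 0 < #|A i|%:R :> R.
  by have := AE0 i; rewrite -natrM !ltr0n muln_gt0 => /andP[].
pose g z i : R := #|[set x in A i | dotp x z == 0]|%:R / #|A i|%:R.
have g01 z i : 0 <= g z i <= 1.
  rewrite divr_ge0 //= ler_pdivrMr // mul1r ler_nat subset_leq_card //.
  by apply/subsetP => x; rewrite inE => /andP[].
have moment i :
    \sum_(y in E) \sum_(y' in E) (g (y - y') i - q^-1) ^+ 2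
      <= #|E|%:R ^+ 2 / q ^+ l.
  (* For fixed y the differences y - y' are distinct, so the inner sum extends to all z; the sum
     over y then costs a factor |E|. *)
  apply: (@le_trans _ _ (\sum_(y in E) \sum_z (g z i - q^-1) ^+ 2)).
    apply: ler_sum => y _.
    rewrite [leRHS](reindex_inj (can_inj (subKr y))) /=.
    rewrite big_mkcond; apply: ler_sum => z _.
    by case: ifP => // _; apply: sqr_ge0.
  rewrite sumr_const.
  have -> : \sum_z (g z i - q^-1) ^+ 2 =
      (\sum_z (#|[set x in A i | dotp x z == 0]|%:R - #|A i|%:R / q) ^+ 2)
        / #|A i|%:R ^+ 2.
    rewrite big_distrl; apply: eq_bigr => z _ /=.
    by rewrite /g; field; rewrite !gt_eqF.
  rewrite -[leLHS]mulr_natl [in leRHS]expr2 -[leRHS]mulrA ler_wpM2l //.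
  rewrite ler_pdivrMr ?exprn_gt0 //; apply: le_trans (orthogonal_variance _ _ _ _) _.
  (* The size hypothesis enters here, as q^d / |A_i| <= |E| / q^l. *)
  rewrite -/q mulrAC ler_pdivlMr ?exprn_gt0 // -mulrA -exprD expr2 mulrCA.
  by rewrite ler_wpM2l // mulrC large.
apply: (@le_trans _ _ (\sum_(y in E) \sum_(y' in E)
   ((2 * q^-1) ^+ l + 4 * \sum_i (g (y - y') i - q^-1) ^+ 2))).
  apply: ler_sum => y _; apply: ler_sum => y' _.
  by apply: (prod_le_moments R l (g (y - y')) q^-1) => //; rewrite invr_ge0 ltW.
under eq_bigr => y _ do rewrite big_split /= -big_distrr /= sumr_const exchange_big /=.
rewrite big_split /= sumr_const -big_distrr /= exchange_big /= [leRHS]mulrDl lerD //.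
  rewrite exprMn exprVn -mulrnA -[leLHS]mulr_natr natrM -expr2.
  by rewrite -mulrA [_^-1 * _]mulrC.
rewrite -mulrA ler_pM2l // mulr_natl -[X in _ *+ X]card_ord -sumr_const.
by apply: ler_sum => i _; apply: moment.
Qed.

(** * Collisions of dot products and the final estimate *)

Lemma sqr_card_le_collisions (F : finFieldType) (d l : nat)
    (A : 'I_l.+1 -> {set 'rV[F]_d}) (S : {set {ffun 'I_l.+1 -> 'rV[F]_d}}) :
  S \subset prodset A ->
  (#|S| ^ 2 <= (\sum_(x in shadow A S) #|dotprods x (fiber A S x)|) *
     \sum_(y in A ord_max) \sum_(y' in A ord_max)
        \prod_(i < l) #|[set x in A (init_ord i) | dotp x (y - y') == 0%R]|)%N.
Proof.
move=> SA; pose V := 'rV[F]_d.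
pose T := [set p : {ffun 'I_l -> V} * V | snoc p.1 p.2 \in S].
have snoc_init (x : {ffun 'I_l -> V}) y i : snoc x y (init_ord i) = x i.
  by rewrite ffunE; case: insubP => [j _ /val_inj -> //|]; rewrite /= ltn_ord.
have snoc_last (x : {ffun 'I_l -> V}) y : snoc x y ord_max = y.
  by rewrite ffunE; case: insubP => //= j; rewrite ltnn.
have inT x y : (x, y) \in T -> x \in shadow A S /\ y \in fiber A S x.
  rewrite inE /= => xyS; have := subsetP SA _ xyS; rewrite inE => /forallP xyA.
  have yA : y \in A ord_max by have := xyA ord_max; rewrite snoc_last.
  rewrite !inE yA; split=> //; apply/andP; split.
    by apply/forallP => i; have := xyA (init_ord i); rewrite snoc_init.
  by apply/existsP; exists y; rewrite yA.
have cardS : (#|S| <= #|T|)%N.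
  apply: leq_trans (leq_imset_card (fun p => snoc p.1 p.2) T).
  apply/subset_leq_card/subsetP => s sS.
  have sE : s = snoc [ffun i => s (init_ord i)] (s ord_max).
    apply/ffunP => i; rewrite ffunE; case: insubP => [j _ ji|].
      by rewrite ffunE; congr (s _); apply: val_inj.
    rewrite -leqNgt => li; congr (s _); apply: val_inj => /=.
    by apply/eqP; rewrite eqn_leq li -ltnS ltn_ord.
  by apply/imsetP; exists ([ffun i => s (init_ord i)], s ord_max); rewrite ?inE -?sE.
(* Keeping x in the value of [phi] makes its image a disjoint union of sets of dot products over S',
   and forces colliding pairs to share x. *)
pose phi (p : {ffun 'I_l -> V} * V) := (p.1, \row_(i < l) dotp (p.1 i) p.2).
apply: leq_trans (leq_trans _ (card_imset_collisions _ _ phi T)) _.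
  by rewrite leq_exp2r.
apply: leq_mul.
  under eq_bigr => x _ do rewrite -sum1_card.
  rewrite pair_big_dep /= sum1dep_card; apply/subset_leq_card/subsetP => u.
  case/imsetP => -[x y] /inT[xS yS] ->; rewrite inE /= xS.
  by apply/imsetP; exists y.
pose Z := [set u : V * V * {ffun 'I_l -> V} |
  [&& u.1.1 \in A ord_max, u.1.2 \in A ord_max &
  [forall i, u.2 i \in [set x in A (init_ord i) | dotp x (u.1.1 - u.1.2) == 0%R]]]].
apply: (@leq_trans #|Z|); last first.
  (* Once y and y' are fixed, the conditions on the x_i are independent, so the count factors. *)
  have cardZ (y y' : V) :
      (\prod_(i < l) #|[set x in A (init_ord i) | dotp x (y - y') == 0%R]|)%N =
      (\sum_(x : {ffun 'I_l -> V} | [forall i, x i \in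
         [set x in A (init_ord i) | dotp x (y - y') == 0%R]]) 1)%N.
    under eq_bigr => i _ do rewrite -sum1_card.
    by rewrite bigA_distr_big_dep; apply: eq_bigr => f _; rewrite big1.
  under eq_bigr => y _ do under eq_bigr => y' _ do rewrite cardZ.
  rewrite pair_big_dep pair_big_dep /= sum1dep_card.
  by apply/subset_leq_card/subsetP => u; rewrite !inE andbA.
(* Injective on collisions, since the forgotten second copy of x equals the first. *)
pose tr (p : ({ffun 'I_l -> V} * V) * ({ffun 'I_l -> V} * V)) :=
  ((p.1.2, p.2.2), p.1.1).
rewrite -(card_in_imset (f := tr)); last first.
  case=> -[x1 y1] [x1' y1'] [[x2 y2] [x2' y2']].
  rewrite !inE => /and3P[_ _ /eqP[e1 _]] /and3P[_ _ /eqP[e2 _]] [e3 e4 e5].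
  by move: e1 e2 e3 e4 e5 => /= -> -> -> -> ->.
apply/subset_leq_card/subsetP => _ /imsetP[[[x y] [x' y']] + ->].
case/setIdP => /inT[/= xS yS] /andP[/inT[/= _ y'S] /eqP[<- /rowP eqxy]].
move: xS yS y'S; rewrite !inE => /andP[/forallP xA _] /andP[yA _] /andP[y'A _].
apply/and3P; split=> //=; apply/forallP => i; rewrite inE xA /=.
by have := eqxy i; rewrite !mxE dotpBr => ->; rewrite subrr.
Qed.

Theorem theorem6 (R : realType) (l : nat) (hl : (2 <= l)%N) :
  exists2 C : R, 0 < C &
  forall d : nat, (l <= d)%N ->
  forall K : R, 0 < K ->
  exists2 K' : R, 0 < K' &
  forall (F : finFieldType) (A : 'I_l.+1 -> {set 'rV[F]_d})
         (S : {set {ffun 'I_l.+1 -> 'rV[F]_d}}),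
    S \subset prodset A ->
    lessgtrsim K #|S|%:R (\prod_(i < l.+1) #|A i|%:R) ->
    (forall i : 'I_l,
       C * #|F|%:R ^+ (d + l) <= #|A (init_ord i)|%:R * #|A ord_max|%:R) ->
    lesssim K' (#|F|%:R ^+ l)
      (#|shadow A S|%:R^-1 *
       \sum_(x in shadow A S) #|dotprods x (fiber A S x)|%:R).
Proof.
exists 1 => // d _ K K0.
pose c : R := 2 ^+ l + 4 * l%:R.
have c0 : 0 < c by rewrite ltr_wpDr ?exprn_gt0 // mulr_ge0.
exists (K ^+ 2 * c) => [|F A S SA [_ KS] large]; first by rewrite mulr_gt0 ?exprn_gt0.
have {}large i : #|F|%:R ^+ (d + l) <= #|A (init_ord i)|%:R * #|A ord_max|%:R :> R.
  by rewrite -[leLHS]mul1r.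
have q0 : 0 < #|F|%:R :> R by rewrite ltr0n; apply/card_gt0P; exists 0.
have AE0 i : (0 < #|A (init_ord i)|)%N && (0 < #|A ord_max|)%N.
  rewrite -muln_gt0 -(ltr0n R) natrM.
  by apply: lt_le_trans (large i); rewrite exprn_gt0.
have E0 : 0 < #|A ord_max|%:R :> R.
  by have /andP[] := AE0 (Ordinal (ltnW hl)); rewrite ltr0n.
have A0 i : 0 < #|A (init_ord i)|%:R :> R by have /andP[] := AE0 i; rewrite ltr0n.
pose a : R := \prod_(i < l) #|A (init_ord i)|%:R.
have a0 : 0 < a by apply: prodr_gt0.
have prodA : \prod_(i < l.+1) #|A i|%:R = a * #|A ord_max|%:R :> R.
  by rewrite big_ord_recr.
rewrite /lesssim prodA in KS.
have S0 : (0 < #|S|)%N.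
  by rewrite -(ltr0n R) -(pmulr_rgt0 _ K0); apply: lt_le_trans KS; rewrite mulr_gt0.
set P : R := \sum_(x in _) _; set n : R := #|shadow A S|%:R.
have := sqr_card_le_collisions _ _ _ _ _ SA.
rewrite -(ler_nat R) natrM natrX natr_sum -/P natr_sum => SP.
have collisions_le : \sum_(y in A ord_max) (\sum_(y' in A ord_max)
    \prod_(i < l) #|[set x in A (init_ord i) | dotp x (y - y') == 0%R]|)%:R
    <= a * (c * (#|A ord_max|%:R ^+ 2 / #|F|%:R ^+ l)) :> R.
  rewrite mulrC -ler_pdivrMr // big_distrl.
  apply: le_trans (sum_prod_orthogonal_le _ _ _ _ _ _ hl large).
  apply: ler_sum => y _; rewrite natr_sum big_distrl /=.
  by apply: ler_sum => y' _; rewrite natr_prod prodf_div.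
have P0 : 0 <= P by apply: sumr_ge0.
(* This bound reduces the claim on the average over S' to a q^l <= K' P. *)
have n_le : n <= a.
  rewrite /n /a -natr_prod ler_nat.
  apply: (@leq_trans #|prodset (fun i => A (init_ord i))|).
    by apply/subset_leq_card/subsetP => x; rewrite inE => /andP[].
  under [leqRHS]eq_bigr => i _ do rewrite -sum1_card.
  rewrite bigA_distr_big_dep -sum1_card leq_eqVlt; apply/orP; left; apply/eqP.
  apply: eq_big => [x|x _]; last by rewrite big1.
  by rewrite inE.
(* An empty S' would give P = 0, hence |S| = 0. *)
have n0 : 0 < n.
  rewrite ltr0n; case: (posnP #|shadow A S|) => // n0.
  have P00 : P = 0 by rewrite /P (cards0_eq n0) big_set0.
  by move: SP; rewrite P00 mul0r leNgt exprn_gt0 // ltr0n.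
rewrite /lesssim mulrCA ler_pdivlMl //.
apply: (@le_trans _ _ (a * #|F|%:R ^+ l)); first by rewrite ler_wpM2r // exprn_ge0 // ltW.
have KS2 : (a * #|A ord_max|%:R) ^+ 2 <= K ^+ 2 * #|S|%:R ^+ 2.
  by rewrite -exprMn lerXn2r // nnegrE mulr_ge0 // ltW.
have {}SP := le_trans SP (ler_wpM2l P0 collisions_le).
(* Multiplying the goal by this factor turns its left side into the square of the product of all
   |A_i|, which [KS2] and [SP] bound. *)
have scale0 : 0 < a * #|A ord_max|%:R ^+ 2 / #|F|%:R ^+ l :> R.
  by rewrite divr_gt0 ?mulr_gt0 ?exprn_gt0.
have Q0 : #|F|%:R ^+ l != 0 :> R by rewrite expf_neq0 ?gt_eqF.
rewrite -(ler_pM2r scale0) [leLHS](_ : _ = (a * #|A ord_max|%:R) ^+ 2); last first.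
  move: Q0; move: (_ ^+ l) => Q Q0; by field.
apply: le_trans (le_trans KS2 (ler_wpM2l (ltW (exprn_gt0 2 K0)) SP)) _.
rewrite le_eqVlt; apply/orP; left; apply/eqP.
move: Q0; move: (_ ^+ l) => Q Q0; clearbody a c P; by field.
Qed.
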